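(* Let $(W,S)$ be a Coxeter system. Consider a random walk on $W$ started at the identity $1_W$ which, at each step, multiplies the current element on the right by $s\in S$ with probability $p_s$, or by $1_W$ with probability $p_{\mathrm{id}}$ (where $p_{\mathrm{id}}+\sum_{s\in S} p_s = 1$). Suppose $p_s < p_{\mathrm{id}}$ for every $s\in S$. Let $P^n(x)$ be the probability that the walk is at $x\in W$ after $n$ steps. Then for every $n\ge 0$ and all $w,w'\in W$ with $w\leq_B w'$, we have $P^n(w)\geq P^n(w')$.
   Context: A Coxeter system $(W,S)$ is a group $W$ with generating set $S=\{s_1,\dots,s_k\}$ and presentation $\langle s_1,\dots,s_k \mid s_i^2,\ (s_is_j)^{m_{ij}}\ (i\neq j)\rangle$, where each $m_{ij}$ ($i\ne j$) is an integer $\geq 2$ or $\infty$. The (right) weak Bruhat order $\leq_B$ on $W$ is defined by $w \leq_B w'$ iff there is a reduced word for $w$ which can be extended by multiplying on the right by elements of $S$ to obtain a reduced word for $w'$; equivalently, some shortest path from $1_W$ to $w'$ in the Cayley graph $\Gamma(W,S)$ passes through $w$. *)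

(* Defs.v *)
From HB Require Import structures.
From mathcomp Require Import all_boot all_order all_algebra.
From mathcomp Require Import all_classical all_reals all_analysis.

Set Implicit Arguments.
Unset Strict Implicit.
Unset Printing Implicit Defensive.

Local Open Scope classical_set_scope.
Local Open Scope ring_scope.

(* Group presentations.  [(i, false)] stands for the i-th generator and
   [(i, true)] for its formal inverse. *)
Definition letter (I : Type) : Type := (I * bool)%type.

Definition letter_inv (I : Type) (x : letter I) : letter I := (x.1, ~~ x.2).

(* The classes of [word_equiv rel] are the elements of the group < I | rel >,
   with concatenation as product. *)
Inductive word_equiv (I : Type) (rel : seq (letter I) -> Prop) :
    seq (letter I) -> seq (letter I) -> Prop :=
| word_equiv_refl u : word_equiv rel u u
| word_equiv_sym u v : word_equiv rel u v -> word_equiv rel v u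
| word_equiv_trans u v w :
    word_equiv rel u v -> word_equiv rel v w -> word_equiv rel u w
| word_equiv_cancel u x v :
    word_equiv rel (u ++ [:: x; letter_inv x] ++ v) (u ++ v)
| word_equiv_relator u r v :
    rel r -> word_equiv rel (u ++ r ++ v) (u ++ v).

Definition letter_val (W : groupType) (I : Type) (s : I -> W) (x : letter I) : W :=
  if x.2 then (s x.1)^-1%g else s x.1.

Definition signed_word_val (W : groupType) (I : Type) (s : I -> W)
    (u : seq (letter I)) : W :=
  (\prod_(x <- u) letter_val s x)%g.

(* The map from < I | rel > to [W] induced by [s] is well defined and
   bijective. *)
Definition has_presentation (W : groupType) (I : Type) (s : I -> W)
    (rel : seq (letter I) -> Prop) : Prop :=
  (forall w : W, exists u, signed_word_val s u = w) /\
  (forall u v, signed_word_val s u = signed_word_val s v <-> word_equiv rel u v).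

(* [m i j = Some n] means m_ij = n, and [m i j = None] means that m_ij is
   infinite; the diagonal of [m] is never used. *)
Definition coxeter_matrix (k : nat) (m : 'I_k -> 'I_k -> option nat) : Prop :=
  forall i j, i != j ->
    m i j = m j i /\ (forall n, m i j = Some n -> (2 <= n)%N).

Inductive coxeter_relator (k : nat) (m : 'I_k -> 'I_k -> option nat) :
    seq (letter 'I_k) -> Prop :=
| coxeter_square i : coxeter_relator m [:: (i, false); (i, false)]
| coxeter_braid i j n : i != j -> m i j = Some n ->
    coxeter_relator m (flatten (nseq n [:: (i, false); (j, false)])).

Definition coxeter_system (W : groupType) (k : nat) (s : 'I_k -> W)
    (m : 'I_k -> 'I_k -> option nat) : Prop :=
  coxeter_matrix m /\ has_presentation s (coxeter_relator m).

Definition word_val (W : groupType) (k : nat) (s : 'I_k -> W)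
    (u : seq 'I_k) : W :=
  (\prod_(i <- u) s i)%g.

Definition reduced_word (W : groupType) (k : nat) (s : 'I_k -> W)
    (u : seq 'I_k) : Prop :=
  forall v, word_val s v = word_val s u -> (size u <= size v)%N.

Definition weak_bruhat_le (W : groupType) (k : nat) (s : 'I_k -> W)
    (w w' : W) : Prop :=
  exists u v : seq 'I_k,
    [/\ reduced_word s u, word_val s u = w,
        reduced_word s (u ++ v) & word_val s (u ++ v) = w'].

(* A step of the walk is [Some i] (multiply by [s i]) or [None] (stay). *)
Definition step_val (W : groupType) (k : nat) (s : 'I_k -> W)
    (a : option 'I_k) : W :=
  if a is Some i then s i else 1%g.

Definition step_law (R : realType) (k : nat) (pid : R) (p : 'I_k -> R)
    (a : option 'I_k) : R :=
  if a is Some i then p i else pid.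

Definition iid_steps (d : measure_display) (T : measurableType d)
    (R : realType) (P : probability T R) (k : nat) (pid : R) (p : 'I_k -> R)
    (xi : nat -> T -> option 'I_k) : Prop :=
  [/\ (forall n a, measurable [set t | xi n t = a]),
      (forall n a, P [set t | xi n t = a] = (step_law pid p a)%:E)
    & (forall (J : seq nat) (a : nat -> option 'I_k), uniq J ->
        P (\bigcap_(j in [set` J]) [set t | xi j t = a j]) =
        (\prod_(j <- J) P [set t | xi j t = a j])%E)].

Fixpoint walk (W : groupType) (k : nat) (s : 'I_k -> W) (T : Type)
    (xi : nat -> T -> option 'I_k) (n : nat) (t : T) : W :=
  if n is n'.+1 then (walk s xi n' t * step_val s (xi n' t))%g else 1%g.

Definition walk_prob (d : measure_display) (T : measurableType d)
    (R : realType) (P : probability T R) (W : groupType) (k : nat)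
    (s : 'I_k -> W) (xi : nat -> T -> option 'I_k) (n : nat) (x : W) : \bar R :=
  P [set t | walk s xi n t = x].

(* Main.v *)
(* For a reflection r, call x positive if r does not separate x from 1.  By
   induction on n, P^n(x) >= P^n(r x) whenever x is positive for r: among the
   neighbours x s_t, either x s_t is again positive, and the induction hypothesis
   compares P^n(x s_t) with P^n(r x s_t), or x s_t = r x, which happens for at
   most one t and is compensated by the lazy step because p_t < p_id.  If
   l(w s_i) > l(w), then w s_i = r w with r = w s_i w^-1 and w is positive for r.
   Separation is defined by the parity of the number of times r occurs among the
   reflections along a word (Tits' action of W on reflections with signs), and
   the geometric representation shows that the s_i are pairwise distinct. *)
Require Import Defs.
From HB Require Import structures.
From mathcomp Require Import all_boot all_order all_algebra.
From mathcomp Require Import all_classical all_reals all_analysis.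
From mathcomp Require Import ring lra.
Set Implicit Arguments.
Unset Strict Implicit.
Unset Printing Implicit Defensive.
Import Order.TTheory GRing.Theory Num.Theory.
Local Open Scope ring_scope.

(** * Coxeter relations and actions of the group *)

Section CoxeterGroup.
Variables (W : groupType) (k : nat) (s : 'I_k -> W).
Variables (m : 'I_k -> 'I_k -> option nat) (hW : coxeter_system s m).

Lemma word_val_cat u v : word_val s (u ++ v) = (word_val s u * word_val s v)%g.
Proof. by rewrite /word_val big_cat. Qed.

Lemma word_val_rcons u i : word_val s (rcons u i) = (word_val s u * s i)%g.
Proof. by rewrite -cats1 word_val_cat {2}/word_val big_seq1. Qed.

Lemma relator_val1 r : coxeter_relator m r -> signed_word_val s r = 1%g.
Proof.
move=> hr; have [_ [_ /(_ r [::])]] := hW.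
rewrite {2}/signed_word_val big_nil => ->.
by have := word_equiv_relator [::] [::] hr; rewrite /= cats0.
Qed.

Lemma gen_sqr i : (s i * s i)%g = 1%g.
Proof.
have := relator_val1 (coxeter_square m i).
by rewrite /signed_word_val big_cons big_seq1.
Qed.

Lemma gen_inv i : (s i)^-1%g = s i.
Proof. exact: mulg1_eq (gen_sqr i). Qed.

Lemma gen_conj i : (s i ^ s i)%g = s i.
Proof. by rewrite conjgE gen_sqr mulg1 gen_inv. Qed.

Lemma gen_braid i j n : i != j -> m i j = Some n -> ((s i * s j) ^+ n)%g = 1%g.
Proof.
move=> ij mij; rewrite -(relator_val1 (coxeter_braid ij mij)).
elim: n {mij} => [|n IHn]; first by rewrite /signed_word_val big_nil.
by rewrite expgS IHn /= /signed_word_val !big_cons mulgA.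
Qed.

Lemma signed_word_valE u : signed_word_val s u = word_val s (map fst u).
Proof.
rewrite /signed_word_val /word_val big_map; apply: eq_bigr => -[i b] _.
by case: b => //; exact: gen_inv.
Qed.

(* The universal property of the presentation. *)
Lemma coxeter_action (X : Type) (f : 'I_k -> X -> X) :
    (forall i, involutive (f i)) ->
    (forall i j n, i != j -> m i j = Some n ->
      forall x, iter n (fun y => f j (f i y)) x = x) ->
  forall u v, word_val s u = word_val s v ->
  forall x, foldl (fun y i => f i y) x u = foldl (fun y i => f i y) x v.
Proof.
move=> fK fbraid u v uv x.
pose F y := foldl (fun y (l : letter 'I_k) => f l.1 y) y.
have FE w y : foldl (fun y i => f i y) y w = F y (map (pair^~ false) w).
  by elim: w y => //= i w IHw y; rewrite IHw.
have : word_equiv (coxeter_relator m) (map (pair^~ false) u)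
                                      (map (pair^~ false) v).
  have [_ [_ <-]] := hW; rewrite !signed_word_valE -!map_comp.
  by rewrite !(@eq_map _ _ (fst \o pair^~ false) id) // !map_id.
rewrite !FE; move: (map _ u) (map _ v) => {uv}u {}v.
move=> uv; elim: uv x => {u v} //=.
- by move=> u v w _ IH1 _ IH2 x; rewrite IH1.
- by move=> u [i b] v x; rewrite /F foldl_cat /= fK foldl_cat.
move=> u r v hr x; rewrite /F !foldl_cat; congr foldl.
move: (foldl _ x u) => {}x; case: hr => [i|i j n ij mij]; first exact: fK.
rewrite -[RHS](fbraid i j n ij mij).
by elim: n {mij} x => //= n IHn x; rewrite IHn -iterSr.
Qed.

(** * Tits' action on signed reflections, taken on all of [W] to avoid a subtype of reflections *)

Definition refl_step (i : 'I_k) (y : W * bool) : W * bool :=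
  ((y.1 ^ s i)%g, y.2 (+) (y.1 == s i)).

Lemma refl_stepK i : involutive (refl_step i).
Proof.
move=> [r e]; rewrite /refl_step /= -conjgM gen_sqr conjg1.
have -> : ((r ^ s i)%g == s i) = (r == s i).
  by rewrite -{2}(gen_conj i) (inj_eq (@conjg_inj _ (s i))).
by rewrite -addbA addbb addbF.
Qed.

Lemma conjg_eq (x y z : W) : ((x ^ y)%g == z) = (x == (z ^ y^-1)%g).
Proof. by rewrite -(inj_eq (@conjg_inj _ y)) conjgKV. Qed.

(** Since [s i] conjugates the rotation [s i * s j] to its inverse, moving it past a power of the
    rotation doubles the exponent. *)
Lemma gen_conj_rotation i j a :
  (s i ^ ((s i * s j) ^+ a)^-1)%g = ((s i * s j) ^+ (a + a) * s i)%g.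
Proof.
have flip : ((s i * s j) ^+ a * s i * (s i * s j) ^+ a)%g = s i.
  elim: a => [|a IHa]; first by rewrite mul1g mulg1.
  rewrite {1}expgSr expgS !mulgA -[(_ * s i * s j * s i * s i)%g]mulgA gen_sqr.
  by rewrite mulg1 -[(_ * s j * s j)%g]mulgA gen_sqr mulg1 IHa.
rewrite conjgE invgK expgnDr -mulgA; congr (_ * _)%g.
by apply/eqP; rewrite divg_eq flip.
Qed.

(* The reflections met along the word (s_i s_j)^a, in order, are the
   (s_i s_j)^b s_i for b < 2a. *)
Lemma iter_refl_step i j a r e :
  iter a (fun y => refl_step j (refl_step i y)) (r, e) =
  ((r ^ ((s i * s j) ^+ a))%g,
   e (+) \big[addb/false]_(0 <= b < a + a) (r == ((s i * s j) ^+ b * s i)%g)).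
Proof.
elim: a => [|a IHa]; first by rewrite big_nil conjg1 addbF.
rewrite iterS IHa /refl_step /= addSn addnS !big_nat_recr //=.
rewrite -!conjgM !addbA expgSr !mulgA !conjg_eq gen_conj_rotation.
congr (_, _ (+) (r == _)).
rewrite invgM conjgM.
have -> : (s j ^ (s i)^-1 = s i * s j * s i)%g.
  by rewrite conjgE invgK gen_inv mulgA.
rewrite conjMg gen_conj_rotation [in RHS]expgS -[RHS]mulgA; congr (_ * _)%g.
by rewrite conjgE invgK mulgA -expgSr expgS mulgK.
Qed.

(** As (s_i s_j)^n = 1, the reflections of index b and b + n coincide, so the 2n sign changes cancel
    in pairs. *)
Lemma refl_step_braid i j n : i != j -> m i j = Some n ->
  forall y, iter n (fun y => refl_step j (refl_step i y)) y = y.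
Proof.
move=> ij mij [r e]; have g1 := gen_braid ij mij.
rewrite iter_refl_step g1 conjg1 (@big_cat_nat _ _ _ n) ?leq_addr //=.
rewrite -{2}(add0n n) big_addn addnK.
under [X in _ (+) (_ (+) X)]eq_bigr do rewrite expgnDr g1 mulg1.
by rewrite addbb addbF.
Qed.

(** * Inversion parity and the exchange property *)

Definition inv_parity (u : seq 'I_k) (r : W) : bool :=
  (foldl (fun y i => refl_step i y) (r, false) u).2.

Lemma inv_parity_eq u v r :
  word_val s u = word_val s v -> inv_parity u r = inv_parity v r.
Proof.
move=> uv; rewrite /inv_parity.
by rewrite (coxeter_action refl_stepK refl_step_braid uv).
Qed.

Lemma foldl_refl_step u r e :
  foldl (fun y i => refl_step i y) (r, e) u =
  ((r ^ word_val s u)%g, e (+) inv_parity u r).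
Proof.
elim/last_ind: u e => [|u i IHu] e.
  by rewrite /word_val big_nil conjg1 addbF.
rewrite /inv_parity -cats1 !foldl_cat IHu [foldl _ (r, false) u]IHu.
by rewrite cats1 word_val_rcons conjgM /refl_step /= addbA.
Qed.

Lemma inv_parity_cat u v r :
  inv_parity (u ++ v) r = inv_parity u r (+) inv_parity v (r ^ word_val s u)%g.
Proof. by rewrite {1}/inv_parity foldl_cat !foldl_refl_step. Qed.

Lemma inv_parity1 i r : inv_parity [:: i] r = (r == s i).
Proof. by []. Qed.

Lemma word_val_surj w : exists u, word_val s u == w.
Proof.
by have [_ [/(_ w) [u <-] _]] := hW; exists (map fst u);
   rewrite signed_word_valE eqxx.
Qed.

(* [inverts w r] says that the reflection [r] separates [w] from 1. *)
Definition inverts (w r : W) : bool := inv_parity (xchoose (word_val_surj w)) r.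

Lemma invertsE u r : inverts (word_val s u) r = inv_parity u r.
Proof. exact/inv_parity_eq/eqP/(xchooseP (word_val_surj (word_val s u))). Qed.

Lemma inverts1 r : inverts 1%g r = false.
Proof.
have -> : 1%g = word_val s [::] by rewrite /word_val big_nil.
by rewrite invertsE.
Qed.

Lemma invertsM v w r : inverts (v * w)%g r = inverts v r (+) inverts w (r ^ v)%g.
Proof.
have [a /eqP <-] := word_val_surj v; have [b /eqP <-] := word_val_surj w.
by rewrite -word_val_cat !invertsE inv_parity_cat.
Qed.

Lemma inverts_gen i r : inverts (s i) r = (r == s i).
Proof. by rewrite -inv_parity1 -invertsE /word_val big_seq1. Qed.

Lemma inverts_mul_gen w i r :
  inverts (w * s i)%g r = inverts w r (+) (r == (s i ^ w^-1)%g).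
Proof. by rewrite invertsM inverts_gen conjg_eq. Qed.

(** Along w^-1 s_i w the contributions of w^-1 and w cancel, as they do for the trivial product w^-1
    w; only the middle letter counts. *)
Lemma inverts_self i w : inverts (s i ^ w)%g (s i ^ w)%g.
Proof.
have := inverts1 (s i ^ w)%g.
rewrite -(mulVg w) [inverts (_ * _)%g _]invertsM conjgK.
rewrite {2}conjgE !invertsM !conjgK inverts_gen eqxx gen_conj.
by case: (inverts w^-1 _); case: (inverts w _).
Qed.

(** Strong exchange: an odd count means that [r] is met at some letter, and deleting the first such
    letter multiplies the value by [r] on the left. *)
Lemma inverts_exchange u r : inv_parity u r ->
  exists2 v, word_val s v = (r * word_val s u)%g & (size v < size u)%N.
Proof.
elim: u r => [//|i u IHu] r.
rewrite -cat1s inv_parity_cat inv_parity1 word_val_cat /word_val big_seq1.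
have [-> _|ri /= /IHu [v vE szv]] := eqVneq r (s i).
  by exists u; rewrite ?mulgA ?gen_sqr ?mul1g.
exists (i :: v); last exact: szv.
by rewrite big_cons; rewrite /word_val in vE; rewrite vE conjgE gen_inv !mulgA
   gen_sqr mul1g.
Qed.

(** Otherwise exchange would give w s_i = r w, where r = w s_i w^-1, a word shorter than [u]. *)
Lemma reduced_inverts u i : reduced_word s (rcons u i) ->
  ~~ inverts (word_val s u) (s i ^ (word_val s u)^-1)%g.
Proof.
move=> red; apply/negP; rewrite invertsE => /inverts_exchange [v vE szv].
have /red : word_val s v = word_val s (rcons u i).
  by rewrite vE word_val_rcons conjgE invgK mulgA mulgVK.
by rewrite size_rcons ltnNge (ltnW szv).
Qed.

(** * Geometric representation and distinctness of the generators *)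

Section Geometric.
Variable R : realType.

Section Form.
Variable B : 'I_k -> 'I_k -> R.

(* The reflection v |-> v - 2 B(e_i, v) e_i, in the coordinates B(e_l, v); this
   choice of coordinates makes it harmless that [B] may be degenerate. *)
Definition geo_step (i : 'I_k) (x : 'I_k -> R) : 'I_k -> R :=
  fun l => x l - 2 * x i * B i l.

Lemma geo_stepK i : B i i = 1 -> involutive (geo_step i).
Proof. by move=> Bii x; apply/funext => l; rewrite /geo_step Bii; ring. Qed.

(* [U] is a Chebyshev sequence: U_a = sin (a t) / sin t when c = cos t. *)
Lemma iter_geo_step i j c (U : nat -> R) :
    B i i = 1 -> B j j = 1 -> B i j = - c -> B j i = - c ->
    U 0%N = 0 -> U 1%N = 1 -> (forall a, U a.+2 = 2 * c * U a.+1 - U a) ->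
  forall a x l, iter a (fun y => geo_step j (geo_step i y)) x l =
    x l - 2 * U a * (x i * U a + x j * (2 * c * U a - U a.+1)) * B i l
        - 2 * U a * (x i * U a.+1 + x j * U a) * B j l.
Proof.
move=> Bii Bjj Bij Bji U0 U1 US.
(* A quadratic invariant of the Chebyshev recurrence; below, the two sides of the inductive step
   differ by a multiple of it. *)
have quad a : U a ^+ 2 - 2 * c * U a * U a.+1 + U a.+1 ^+ 2 - 1 = 0.
  elim: a => [|a IHa]; first by rewrite U0 U1; ring.
  by rewrite -[RHS]IHa US; ring.
elim=> [|a IHa] x l; first by rewrite U0 /=; ring.
rewrite iterS /geo_step !IHa Bii Bjj Bij Bji US.
set q := U a; set t := U a.+1.
transitivity (x l - 2 * t * (x i * t + x j * (2 * c * t - (2 * c * t - q))) * B i l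
        - 2 * t * (x i * (2 * c * t - q) + x j * t) * B j l +
  (2 * x i * B i l + (2 * x j + 4 * c * x i) * B j l) *
  (q ^+ 2 - 2 * c * q * t + t ^+ 2 - 1)); first by ring.
by rewrite quad mulr0 addr0.
Qed.

End Form.

Definition geo_angle n : R := pi / n%:R.

(** Tits' bilinear form of the Coxeter matrix; an infinite entry gets angle 0, hence -1. *)
Definition geo_form (i j : 'I_k) : R :=
  if i == j then 1 else if m i j is Some n then - cos (geo_angle n) else - 1.

(** With angle pi / n the Chebyshev value U_n is sin pi / sin (pi / n) = 0, which kills both
    correction terms; n >= 2 keeps the denominator nonzero. *)
Lemma geo_step_braid i j n : i != j -> m i j = Some n ->
  forall x, iter n (fun y => geo_step geo_form j (geo_step geo_form i y)) x = x.
Proof.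
move=> ij mij x; have [mji /(_ _ mij) n2] := hW.1 i j ij.
have n0 : n%:R != 0 :> R by rewrite pnatr_eq0; case: n n2 {mij}.
have sin_neq0 : sin (geo_angle n) != 0.
  rewrite gt_eqF // sin_gt0_pi // divr_gt0 ?pi_gt0 ?ltr0n ?(ltnW n2) //=.
  by rewrite ltr_pdivrMr ?ltr0n ?(ltnW n2) // ltr_pMr ?pi_gt0 // ltr1n.
pose U a : R := sin (a%:R * geo_angle n) / sin (geo_angle n).
apply/funext => l; rewrite (@iter_geo_step _ i j (cos (geo_angle n)) U).
- have -> : U n = 0 by rewrite /U /geo_angle [n%:R * _]mulrC divfK // sinpi mul0r.
  by ring.
- by rewrite /geo_form eqxx.
- by rewrite /geo_form eqxx.
- by rewrite /geo_form (negbTE ij) mij.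
- by rewrite /geo_form eq_sym (negbTE ij) -mji mij.
- by rewrite /U mul0r sin0 mul0r.
- by rewrite /U mul1r divff.
move=> a; rewrite /U.
have -> : a.+2%:R * geo_angle n = a.+1%:R * geo_angle n + geo_angle n.
  by rewrite -natr1; ring.
have -> : a%:R * geo_angle n = a.+1%:R * geo_angle n - geo_angle n.
  by rewrite -natr1; ring.
by rewrite sinD sinB; field.
Qed.

(** On the vector with i-th coordinate 1 and all others 0, the i-th reflection makes coordinate i
    equal to -1, while any other leaves it at 1. *)
Lemma gen_inj : injective s.
Proof.
move=> i j sij; apply/eqP/negPn/negP => ij.
have diag l : geo_form l l = 1 by rewrite /geo_form eqxx.
have wij : word_val s [:: i] = word_val s [:: j].
  by rewrite /word_val !big_seq1.
have := coxeter_action (fun l => geo_stepK (diag l)) geo_step_braid wij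
  (fun l => (l == i)%:R).
move/(congr1 (fun x => x i)); rewrite /= /geo_step eqxx eq_sym (negbTE ij) diag.
by move/addrI/oppr_inj/eqP; rewrite !mulr1 mulr0 mul0r pnatr_eq0.
Qed.

End Geometric.
End CoxeterGroup.

Lemma big_option (V : nmodType) (I : finType) (f : option I -> V) :
  \sum_o f o = f None + \sum_i f (Some i).
Proof.
rewrite (bigD1 None) //= (reindex_omap Some id) //=; last by case.
by congr (_ + _); apply: eq_bigl => i; rewrite eqxx.
Qed.

(** * The law of the walk *)

Section Walk.
Variables (W : groupType) (k : nat) (s : 'I_k -> W).
Variables (R : realType) (pid : R) (p : 'I_k -> R).

(** Conditioning on the last step gives a purely algebraic recursion, so that the comparison needs
    no measure theory. *)
Fixpoint walk_dist (n : nat) (x : W) : R :=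
  if n is n'.+1 then
    \sum_o step_law pid p o * walk_dist n' (x * (step_val s o)^-1)%g
  else (x == 1%g)%:R.

Section Law.
Local Open Scope classical_set_scope.
Variables (d : measure_display) (T : measurableType d) (P : probability T R).
Variables (xi : nat -> T -> option 'I_k) (hxi : iid_steps P pid p xi).

Lemma walk_eqS n x t :
  (walk s xi n.+1 t = x) <-> (walk s xi n t = (x * (step_val s (xi n t))^-1)%g).
Proof. by split=> [<-|/= ->]; rewrite ?mulgK ?mulgVK. Qed.

Lemma measurable_walk n x : measurable [set t | walk s xi n t = x].
Proof.
have [mxi _ _] := hxi; elim: n x => [|n IHn] x /=.
  case: (eqVneq 1%g x) => [->|/eqP x1].
    by rewrite [X in measurable X](_ : _ = setT)//; apply/seteqP; split.
  by rewrite [X in measurable X](_ : _ = set0)//; apply/seteqP; split.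
rewrite [X in measurable X](_ : _ = \bigcup_(o in setT)
    ([set t | walk s xi n t = (x * (step_val s o)^-1)%g] `&`
     [set t | xi n t = o])).
  by apply: fin_bigcup_measurable => // o _; apply: measurableI.
apply/seteqP; split=> [t /(walk_eqS n x t) xt|t [ o _ [/= xt ot]]].
  by exists (xi n t).
by apply/(walk_eqS n x t); rewrite ot.
Qed.

(* Carrying the steps after time [n] along is what makes the induction go
   through, since independence is only given for the steps. *)
Lemma walk_future_prob n x J a : uniq J -> all (leq n) J ->
  P ([set t | walk s xi n t = x] `&`
     \bigcap_(j in [set` J]) [set t | xi j t = a j]) =
  (walk_dist n x * \prod_(j <- J) step_law pid p (a j))%:E.
Proof.
have [mxi lawxi indep] := hxi.
elim: n x J a => [|n IHn] x J a uJ nJ.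
  rewrite /= eq_sym; case: eqVneq => [->|/eqP x1].
    rewrite [X in X `&` _](_ : _ = setT); last by apply/seteqP; split.
    rewrite setTI indep // mul1r -prodEFin; apply: eq_bigr => j _.
    exact: lawxi.
  rewrite [X in X `&` _](_ : _ = set0); last by apply/seteqP; split.
  by rewrite set0I measure0 mul0r.
(* The event is split by the value [o] of step [n]; [b o] adds this value to the prescribed steps,
   so the induction hypothesis applies to [n :: J]. *)
pose b o j := if j == n then o else a j.
have nJ' : n \notin J by apply/negP => /(allP nJ); rewrite ltnn.
have bJ o j : j \in J -> b o j = a j.
  by rewrite /b; case: eqP => // ->; rewrite (negbTE nJ').
pose F o := [set t | walk s xi n t = (x * (step_val s o)^-1)%g] `&`
     \bigcap_(j in [set` n :: J]) [set t | xi j t = b o j].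
rewrite [X in P X](_ : _ = \bigcup_(o in [set` index_enum (option 'I_k)]) F o);
    last first.
  apply/seteqP; split=> [t [/(walk_eqS n x t) xt tJ]|t [ o _ [/= xt tJ]]].
    exists (xi n t); first exact: mem_index_enum.
    split=> // j /=; rewrite inE => /orP[/eqP ->|jJ]; first by rewrite /b eqxx.
    by rewrite bJ //; exact: tJ.
  have ot : xi n t = o by rewrite (tJ n) /= ?mem_head // /b eqxx.
  split; first by apply/(walk_eqS n x t); rewrite ot.
  by move=> j /= jJ; rewrite (tJ j) /= ?bJ // inE jJ orbT.
rewrite measure_fin_bigcup //.
- rewrite -fsbig_seq ?index_enum_uniq // mulr_suml -sumEFin.
  apply: eq_bigr => o _; rewrite [LHS](IHn _ (n :: J) (b o)) /= ?nJ' ?uJ ?leqnn //=; last first.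
    by apply: sub_all nJ => j; exact: ltnW.
  rewrite big_cons {1}/b eqxx mulrCA mulrA; congr (_ * _)%:E.
  by apply: eq_big_seq => j jJ; rewrite bJ.
- move=> o o' _ _ [t [[_ /(_ n)] /= + [_ /(_ n) /=]]].
  by rewrite mem_head /b eqxx => /(_ isT) -> /(_ isT).
move=> o _; apply: measurableI; first exact: measurable_walk.
by apply: fin_bigcap_measurable => // j _; exact: mxi.
Qed.

Lemma walk_probE n x : walk_prob P s xi n x = (walk_dist n x)%:E.
Proof.
have := @walk_future_prob n x [::] (fun=> None) isT isT.
by rewrite big_nil mulr1 set_nil bigcap_set0 setIT.
Qed.

End Law.
End Walk.

(** The right side minus the left is (a - b)(y - x) + (v - u). *)
Lemma swap_weights_le (R : realDomainType) (a b x y u v : R) :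
  x <= y -> b <= a -> u <= v -> a * x + (b * y + u) <= a * y + (b * x + v).
Proof. by move=> xy ba uv; nra. Qed.

(** * Comparison across the wall of a reflection *)

Section Comparison.
Variables (W : groupType) (k : nat) (s : 'I_k -> W).
Variables (m : 'I_k -> 'I_k -> option nat) (hW : coxeter_system s m).
Variables (R : realType) (pid : R) (p : 'I_k -> R).

Lemma walk_distS n x : walk_dist s pid p n.+1 x =
  pid * walk_dist s pid p n x + \sum_i p i * walk_dist s pid p n (x * s i)%g.
Proof.
rewrite /= big_option /= invg1 mulg1; congr (_ + _).
by apply: eq_bigr => i _; rewrite (gen_inv hW).
Qed.

(* The only edge from [w] that can cross the wall of [r] leads to [r * w], and
   it is paid for by the lazy step, since its probability is less than [pid]. *)
Lemma walk_dist_reflection (pid_ge0 : 0 <= pid) (p_ge0 : forall i, 0 <= p i)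
    (p_lt_pid : forall i, p i < pid) n j y w :
  ~~ inverts hW w (s j ^ y)%g ->
  walk_dist s pid p n (s j ^ y * w)%g <= walk_dist s pid p n w.
Proof.
set r := (s j ^ y)%g.
have rr : (r * r = 1)%g by rewrite -conjMg (gen_sqr hW) conj1g.
elim: n w => [|n IHn] w wr.
  rewrite /=; case: eqP => [rw1|_]; last exact: ler0n.
  have wE : w = r by rewrite -(mulg1_eq rw1); exact: mulg1_eq.
  by rewrite wE inverts_self in wr.
rewrite !walk_distS; have le_w := IHn w wr.
have [t|no_cross] := pickP (fun t => inverts hW (w * s t)%g r); last first.
  apply: lerD; first exact: ler_wpM2l.
  apply: ler_sum => i _; apply: ler_wpM2l => //.
  by rewrite -mulgA; apply: IHn; rewrite no_cross.
rewrite inverts_mul_gen (negbTE wr) => /eqP rt.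
have wt : (w * s t = r * w)%g by rewrite rt conjgE invgK mulgA mulgVK.
have rwt : (r * w * s t = w)%g by rewrite -mulgA wt mulgA rr mul1g.
rewrite (bigD1 t) // [X in _ <= _ + X](bigD1 t) //= rwt wt.
have : \sum_(i | i != t) p i * walk_dist s pid p n (r * w * s i)%g <=
       \sum_(i | i != t) p i * walk_dist s pid p n (w * s i)%g.
  apply: ler_sum => i it; apply: ler_wpM2l => //.
  (* A second crossing edge [i] would force s_i = s_t, hence i = t by injectivity of the
     generators. *)
  rewrite -mulgA; apply: IHn; rewrite inverts_mul_gen (negbTE wr) /= rt.
  rewrite (inj_eq (@conjg_inj _ _)) eq_sym; apply: contra it => /eqP.
  by move/(gen_inj hW R) => ->.
exact: swap_weights_le le_w (ltW (p_lt_pid t)).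
Qed.

End Comparison.

Theorem theorem3p7 (W : groupType) (k : nat) (s : 'I_k -> W)
    (m : 'I_k -> 'I_k -> option nat) (hW : coxeter_system s m)
    (R : realType) (pid : R) (p : 'I_k -> R)
    (pid_ge0 : 0 <= pid) (p_ge0 : forall i, 0 <= p i)
    (sum_p : pid + \sum_(i < k) p i = 1)
    (p_lt_pid : forall i, p i < pid)
    (d : measure_display) (T : measurableType d) (P : probability T R)
    (xi : nat -> T -> option 'I_k) (hxi : iid_steps P pid p xi)
    (n : nat) (w w' : W) (hww' : weak_bruhat_le s w w') :
  (walk_prob P s xi n w' <= walk_prob P s xi n w)%E.
Proof.
rewrite !(walk_probE s hxi) lee_fin.
case: hww' => u [v [_ <- red <-]].
elim/last_ind: v red => [|v i IHv] red; first by rewrite cats0.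
rewrite -rcons_cat in red *.
apply: le_trans (IHv _); last first.
  (* A prefix of a reduced word is reduced: a shorter word for it would shorten the whole. *)
  move=> z zE; rewrite -(leq_add2r 1) !addn1 -!(size_rcons _ i).
  by apply: red; rewrite !word_val_rcons zE.
have := walk_dist_reflection pid_ge0 p_ge0 p_lt_pid n (reduced_inverts hW red).
by rewrite word_val_rcons conjgE invgK mulgA mulgVK.
Qed.
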